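(* Let $\alpha\in(0,1)$ and consider the critical two-sided chameleon dynamics on $\mathbb{Z}$ with success probability $\alpha$. Suppose that the initial colours $\{\xi_i(0): i\in\mathbb{Z}\}$ have a translation invariant joint law $\mathbb{P}_0$, with $\mathbb{P}(\xi_i(0)=R)=p=1-\mathbb{P}(\xi_i(0)=B)$, and let $\mathbb{P}_t$ be the law of $\xi(t)$ on $\{R,B\}^{\mathbb{Z}}$. Then there is $\bar\pi\in[0,1]$, depending on the initial distribution $\mathbb{P}_0$ and on $\alpha$, such that $\mathbb{P}_t$ converges weakly to $\bar\pi\,\delta_{\mathbf R}+(1-\bar\pi)\,\delta_{\mathbf B}$ as $t\to\infty$.
   Context: Critical two-sided chameleon dynamics on $\mathbb{Z}$ with success probability $\alpha$: time is discrete, $t=0,1,2,\dots$. At time $t$ each site $i\in\mathbb{Z}$ carries a colour $\xi_i(t)\in\{R,B\}$ (red or blue); $\xi(t)=(\xi_i(t))_{i\in\mathbb{Z}}$. Let $\{C_R(i,t)\}_{i\in\mathbb{Z},t\ge0}$ and $\{C_B(i,t)\}_{i\in\mathbb{Z},t\ge0}$ be two independent collections of i.i.d. Bernoulli$(\alpha)$ random variables (coin tosses; $1$ is a success, $0$ is a failure), independent of the initial configuration $\xi(0)$. The coin used at site $i$ at time $t$ is $C_{\xi_i(t)}(i,t)$. Put $N_i=\{i-1,i,i+1\}$. All sites update simultaneously: - If $C_{\xi_i(t)}(i,t)=1$ then $\xi_i(t+1)=\xi_i(t)$. - If $C_{\xi_i(t)}(i,t)=0$, then site $i$ keeps its colour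 if the proportion of successes among the coins used at time $t$ by the sites in $N_i$ having the same colour as $i$ at time $t$ is larger than or equal to the proportion of successes among the coins used at time $t$ by the sites in $N_i$ having the other colour; otherwise it switches to the other colour. (If no site of $N_i$ has the other colour, that colour's proportion is taken to be $0$, so site $i$ keeps its colour.) $\{R,B\}^{\mathbb{Z}}$ carries the product topology and product $\sigma$-algebra. A probability measure on it is translation invariant if it is invariant under the shifts of $\mathbb{Z}$. $\delta_{\mathbf R}$ (resp. $\delta_{\mathbf B}$) is the probability measure on $\{R,B\}^{\mathbb{Z}}$ giving mass $1$ to the configuration with all sites red (resp. all sites blue). *)

(* Defs.v *)
From HB Require Import structures.
From mathcomp Require Import all_boot all_order all_algebra.
From mathcomp Require Import finmap zify.
From mathcomp Require Import all_classical all_reals all_analysis.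

Set Implicit Arguments.
Unset Strict Implicit.
Unset Printing Implicit Defensive.

Import Order.TTheory GRing.Theory Num.Theory.
Import numFieldNormedType.Exports.

Local Open Scope classical_set_scope.
Local Open Scope ring_scope.

(* A colour is a boolean, so that the discrete topology, the discrete
   sigma-algebra and the negation ("the other colour") of bool can be used. *)
Notation colour := bool (only parsing).
Definition red : colour := true.
Definition blue : colour := false.

Definition config : Type := int -> colour.

HB.instance Definition _ := Pointed.copy config (int -> colour).
HB.instance Definition _ :=
  Topological.copy config (prod_topology (fun _ : int => colour)).

Definition coordinate_events : set (set config) :=
  \bigcup_(i in [set: int])
    preimage_set_system setT (fun x : config => x i) measurable.

HB.instance Definition _ :=
  Measurable.copy config (g_sigma_algebraType coordinate_events).

Definition allred : config := fun=> red.
Definition allblue : config := fun=> blue.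

Definition shift (k : int) (x : config) : config := fun i => x (i + k).

Definition translation_invariant (R : realType) (mu : probability config R) :=
  forall (k : int) (A : set config), measurable A -> mu (shift k @^-1` A) = mu A.

Definition neighbourhood (i : int) : seq int := [:: i - 1; i; i + 1].

(* [coin c j] is the coin of colour c at site j (true is a success); the coin
   used by site j is [coin (x j) j].  As 0 / 0 = 0 in rat, the proportion is 0
   when no site of the neighbourhood has colour c. *)
Definition proportion (x : config) (coin : colour -> int -> bool)
    (i : int) (c : colour) : rat :=
  (count (fun j => (x j == c) && coin (x j) j) (neighbourhood i))%:R
  / (count (fun j => x j == c) (neighbourhood i))%:R.

Definition chameleon_step (x : config) (coin : colour -> int -> bool) : config :=
  fun i =>
    if coin (x i) i then x i
    else if proportion x coin i (~~ x i) <= proportion x coin i (x i) then x i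
    else ~~ x i.

Section chameleon.
Context d (T : measurableType d).

Fixpoint chameleon (xi0 : T -> config) (C : colour -> int -> nat -> T -> bool)
    (t : nat) (w : T) : config :=
  if t is s.+1 then
    chameleon_step (chameleon xi0 C s w) (fun c i => C c i s w)
  else xi0 w.

Lemma measurable_configP (X : T -> config) :
  measurable_fun setT X <-> forall i, measurable_fun setT (fun w => X w i).
Proof.
split=> [mX i _ B mB|mX].
  rewrite setTI; have := mX measurableT ((fun x : config => x i) @^-1` B).
  rewrite setTI; apply; apply: sub_sigma_algebra.
  by exists i => //; exists B => //; rewrite setTI.
apply: (@measurability _ _ _ _ setT X coordinate_events) => //.
move=> _ [_ [i _ [B mB <-]] <-]; rewrite !setTI.
by have := mX i measurableT B mB; rewrite setTI.
Qed.

Lemma measurable_bool_seq (fs : seq (T -> bool)) (h : seq bool -> bool) :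
  {in fs, forall f : T -> bool, measurable_fun setT f} ->
  measurable_fun setT (fun w => h [seq f w | f <- fs]).
Proof.
elim: fs h => [|f fs IH] h mfs /=; first exact: measurable_cst.
have mt b : measurable_fun setT (fun w => h (b :: [seq f w | f <- fs])).
  by apply: (IH (fun s => h (b :: s))) => g gfs; apply: mfs; rewrite inE gfs orbT.
rewrite (_ : (fun w => _) = (fun w =>
  if f w then h (true :: [seq f w | f <- fs])
         else h (false :: [seq f w | f <- fs]))).
  by apply: measurable_fun_ifT => //; apply: mfs; rewrite mem_head.
by apply/funext => w; case: (f w).
Qed.

Lemma measurable_chameleon (xi0 : {mfun T >-> config})
    (C : colour -> int -> nat -> {mfun T >-> bool}) (t : nat) :
  measurable_fun setT (chameleon xi0 C t).
Proof.
elim: t => [|t IH] /=; first exact: measurable_funPT.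
apply/measurable_configP => i; move/measurable_configP: IH => IH.
pose h (s : seq bool) : bool :=
  chameleon_step
    (fun j => if j == i - 1 then nth false s 0 else
              if j == i then nth false s 1 else nth false s 2)
    (fun c j => if j == i - 1 then nth false s (3 + c) else
                if j == i then nth false s (5 + c) else nth false s (7 + c)) i.
pose x j w := chameleon xi0 C t w j.
pose fs := [:: x (i - 1); x i; x (i + 1);
  (C false (i - 1) t : T -> bool); (C true (i - 1) t : T -> bool);
  (C false i t : T -> bool); (C true i t : T -> bool);
  (C false (i + 1) t : T -> bool); (C true (i + 1) t : T -> bool)].
rewrite (_ : (fun w => _) = (fun w => h [seq f w | f <- fs])).
  apply: measurable_bool_seq => f.
  rewrite !inE.
  do 8 (case/orP => [/eqP->|]; [by [exact: IH|exact: measurable_funPT]|]).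
  by move=> /eqP->; exact: measurable_funPT.
apply/funext => w.
have e1 : (i == i - 1) = false by apply/negbTE/eqP; lia.
have e2 : (i + 1 == i - 1) = false by apply/negbTE/eqP; lia.
have e3 : (i + 1 == i) = false by apply/negbTE/eqP; lia.
rewrite /h /chameleon_step /proportion /neighbourhood /= !eqxx e1 e2 e3 /=.
rewrite -/(x (i - 1) w) -/(x i w) -/(x (i + 1) w).
by case: (x (i - 1) w); case: (x i w); case: (x (i + 1) w).
Qed.

HB.instance Definition _ (xi0 : {mfun T >-> config})
    (C : colour -> int -> nat -> {mfun T >-> bool}) (t : nat) :=
  isMeasurableFun.Build _ _ _ _ (chameleon xi0 C t)
    (measurable_chameleon xi0 C t).

End chameleon.

Definition independent_systems d (T : measurableType d) (R : realType)
    (P : probability T R) (I : choiceType) (F : I -> set (set T)) :=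
  forall (J : {fset I}) (E : I -> set T), (forall i, i \in J -> F i (E i)) ->
  P (\bigcap_(i in [set` J]) E i) = (\prod_(i <- J) P (E i))%E.

Definition generated_sigma d d' (T : measurableType d) (S : measurableType d')
    (X : T -> S) : set (set T) :=
  preimage_set_system setT X measurable.

(* The index None stands for the initial configuration and Some (c, i, t) for
   the coin C_c(i, t).  Mutual independence of this whole family says that
   the coins of each colour are independent, that the two collections are
   independent of each other, and that they are jointly independent of the
   initial configuration. *)
Definition chameleon_sources d (T : measurableType d) (xi0 : {mfun T >-> config})
    (C : colour -> int -> nat -> {mfun T >-> bool})
    (k : option (colour * int * nat)) : set (set T) :=
  if k is Some (c, i, t) then generated_sigma (C c i t)
  else generated_sigma xi0.

Definition chameleon_data d (T : measurableType d) (R : realType)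
    (P : probability T R) (alpha : R) (P0 : probability config R)
    (xi0 : {mfun T >-> config})
    (C : colour -> int -> nat -> {mfun T >-> bool}) :=
  [/\ forall A, measurable A -> distribution P xi0 A = P0 A,
      forall c i t A, distribution P (C c i t) A = bernoulli_prob alpha A
    & independent_systems P (chameleon_sources xi0 C)].

Definition weakly_converges (R : realType)
    (mu : nat -> {measure set config -> \bar R})
    (nu : {measure set config -> \bar R}) :=
  forall f : config -> R, continuous f -> bounded_fun f ->
  (\int[mu n]_x (f x)%:E @[n --> \oo] --> \int[nu]_x (f x)%:E)%E.

Definition mixture (R : realType) (q : {i01 R}) :
    {measure set config -> \bar R} :=
  measure_add (mscale q%:num%:nng \d_allred)
              (mscale (1 - q%:num)%:nng \d_allblue).

(* Main.v *)
Require Import Defs.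
From mathcomp Require Import all_boot all_order all_algebra.
From mathcomp Require Import finmap zify ring lra.
From mathcomp Require Import all_classical all_reals all_analysis.
From mathcomp Require Import measurable_realfun.

Set Implicit Arguments.
Unset Strict Implicit.
Unset Printing Implicit Defensive.

Import Order.TTheory GRing.Theory Num.Theory.
Import numFieldNormedType.Exports.

Local Open Scope classical_set_scope.
Local Open Scope ring_scope.

(* The update rule simplifies to: a site flips iff its own coin fails and the
   coin of some neighbour of the opposite colour succeeds.  Hence a boundary
   between two colours performs a symmetric random walk, and boundaries only
   disappear, in pairs.  Write m_t(s) for the probability of seeing the word s
   on consecutive sites at time t.  Letting each boundary carry its mass along
   its naive move shows that the boundary density decreases at each step by at
   least a multiple of f_1(t), the density of runs of length 1; the density of
   red changes by at most f_1(t), so both converge and f_1(t) -> 0.  A run of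
   length k + 1 shrinks to a run of length k with a probability bounded below,
   so f_k(t) -> 0 for every k.  The density of boundaries followed by a run of
   length at least k is at most 1/k, by stationarity, so the boundary density
   tends to 0: large windows become monochromatic, red with limiting
   probability lim m_t(red). *)

(** * Stationary word probabilities and one step of the dynamics *)

Section words.
Variables (A : finType) (R : nmodType).

(** Plain sequences rather than tuples, so that a sum over words can be peeled at either end. *)
Fixpoint words (n : nat) : seq (seq A) :=
  if n is n'.+1 then [seq a :: s | a <- enum A, s <- words n'] else [:: [::]].

Lemma mem_words n s : (s \in words n) = (size s == n).
Proof.
elim: n s => [|n IH] [|a s] //=.
- by apply/allpairsP => -[[b z] [_ _]].
- apply/allpairsP/idP => [[[b z] /= [_ + [_ ->]]]|sn]; first by rewrite IH eqSS.
  by exists (a, s); rewrite mem_enum IH.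
Qed.

Lemma words_uniq n : uniq (words n).
Proof.
elim: n => //= n IH; apply: allpairs_uniq => //; first exact: enum_uniq.
by move=> [a s] [b z] _ _ /= [-> ->].
Qed.

Lemma big_words_cons n (F : seq A -> R) :
  \sum_(z <- words n.+1) F z = \sum_(a : A) \sum_(z <- words n) F (a :: z).
Proof. by rewrite big_allpairs_dep big_enum. Qed.

Lemma big_words_rcons n (F : seq A -> R) :
  \sum_(z <- words n.+1) F z = \sum_(z <- words n) \sum_(a : A) F (rcons z a).
Proof.
elim: n F => [|n IH] F.
  by rewrite big_words_cons big_seq1; apply: eq_bigr => a _; rewrite big_seq1.
rewrite big_words_cons; under eq_bigr do rewrite IH.
by rewrite [RHS]big_words_cons.
Qed.

End words.

(* The colour of a site together with the coin it uses. *)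
Notation site := (bool * bool)%type.

Lemma sum_site (R : nmodType) (F : site -> R) :
  \sum_(a : site) F a = \sum_(b : bool) \sum_(c : bool) F (b, c).
Proof. by rewrite pair_bigA; apply: eq_bigr => -[]. Qed.

Definition upd (a b c : site) : bool :=
  if ~~ b.2 && ((a.1 != b.1) && a.2 || (c.1 != b.1) && c.2)
  then ~~ b.1 else b.1.

(** One step of the dynamics on a window: the two end sites only serve as neighbours, so two letters
    are lost. *)
Fixpoint scan (z : seq site) : seq bool :=
  match z with
  | a :: (b :: c :: _) as z' => upd a b c :: scan z'
  | _ => [::]
  end.

Lemma scan_cons a b c z :
  scan [:: a, b, c & z] = upd a b c :: scan [:: b, c & z].
Proof. by []. Qed.

Lemma scan_rcons z a b c :
  scan (rcons (rcons (rcons z a) b) c) =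
  rcons (scan (rcons (rcons z a) b)) (upd a b c).
Proof.
elim: z => [|u z IH] //.
case: z IH => [|v [|w z]] IH //.
by rewrite !rcons_cons !scan_cons -!rcons_cons IH.
Qed.

(** A site whose coin succeeds keeps its colour whatever its neighbours do. *)
Lemma scan_frozen a z c : all snd z -> scan (a :: rcons z c) = unzip1 z.
Proof.
elim: z a => [|b z IH] a //= /andP[b1 /(IH b)].
by case: z {IH} => [_|d z /= ->]; rewrite /= /upd b1.
Qed.

Section consistent.
Variable R : realFieldType.

(** Kolmogorov consistency at both ends of a word. Since [m] takes no position, this encodes a
    translation invariant law. *)
Definition consistent (m : seq bool -> R) :=
  [/\ forall s, 0 <= m s, m [::] = 1,
      forall s, \sum_(b : bool) m (b :: s) = m s
    & forall s, \sum_(b : bool) m (rcons s b) = m s].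

Variable alpha : R.
Hypothesis alpha01 : 0 < alpha < 1.

Definition coinw (c : bool) : R := if c then alpha else 1 - alpha.

Lemma coinw_gt0 c : 0 < coinw c.
Proof. by have /andP[? ?] := alpha01; rewrite /coinw; case: c; lra. Qed.

Lemma sum_coinw : \sum_(c : bool) coinw c = 1.
Proof. by rewrite big_bool /coinw /= addrC subrK. Qed.

(** Given the colours, the coins in use are independent with parameter [alpha], whichever colour
    selects them. *)
Definition siteM (m : seq bool -> R) (z : seq site) : R :=
  m (unzip1 z) * \prod_(a <- z) coinw a.2.

(* [m s] stands for the probability of the word [s] at [size s] consecutive
   sites; its law after one step involves one more site on each side. *)
Definition nextm (m : seq bool -> R) (s : seq bool) : R :=
  \sum_(z <- words site (size s).+2 | scan z == s) siteM m z.

(** Expectation of a count over a window of [n] sites; inequalities between expectations then reduce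
    to finite case checks. *)
Definition Ex (m : seq bool -> R) n (F : seq site -> nat) : R :=
  \sum_(z <- words site n) siteM m z *+ F z.

Lemma eq_Ex m n F G : (forall z, size z = n -> F z = G z) ->
  Ex m n F = Ex m n G.
Proof.
move=> FG; rewrite /Ex big_seq [RHS]big_seq; apply: eq_bigr => z.
by rewrite mem_words => /eqP /FG ->.
Qed.

Lemma ExD m n F G : Ex m n (fun z => F z + G z)%N = Ex m n F + Ex m n G.
Proof. by rewrite /Ex -big_split; apply: eq_bigr => z _; rewrite mulrnDr. Qed.

Lemma nextmE m s n : size s = n ->
  nextm m s = Ex m n.+2 (fun z => scan z == s).
Proof.
by move=> <-; rewrite /nextm big_mkcond; apply: eq_bigr => z _; case: ifP.
Qed.

Lemma Ex_point m z : Ex m (size z) (fun z' => z' == z) = siteM m z.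
Proof.
rewrite /Ex (bigD1_seq z) ?mem_words ?words_uniq //= eqxx mulr1n.
by rewrite big1 ?addr0 // => i /negbTE ->.
Qed.

Lemma Ex_colour m s : Ex m (size s) (fun z => unzip1 z == s) = m s.
Proof.
elim: s m => [|b s IH] m.
  by rewrite /Ex big_seq1 /siteM /= big_nil mulr1 mulr1n.
rewrite /Ex big_words_cons sum_site exchange_big -[RHS]mul1r -sum_coinw mulr_suml.
apply: eq_bigr => c _; rewrite (bigD1 b) //= [X in _ + X]big1 ?addr0; last first.
  move=> b' /negbTE bb'; rewrite big1_seq // => z _.
  by rewrite eqseq_cons bb' mulr0n.
rewrite -(IH (fun s => m (b :: s))) mulr_sumr; apply: eq_bigr => z _.
by rewrite eqseq_cons eqxx /siteM /= big_cons /= mulrCA mulrnAr.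
Qed.

Variable m : seq bool -> R.
Hypothesis mP : consistent m.

Lemma siteM_ge0 z : 0 <= siteM m z.
Proof.
case: mP => m0 _ _ _; rewrite mulr_ge0 // prodr_ge0 // => a _.
exact/ltW/coinw_gt0.
Qed.

Lemma le_Ex n F G : (forall z, size z = n -> (F z <= G z)%N) ->
  Ex m n F <= Ex m n G.
Proof.
move=> FG; rewrite /Ex big_seq [leRHS]big_seq; apply: ler_sum => z.
by rewrite mem_words => /eqP /FG; apply: ler_wpMn2l; exact: siteM_ge0.
Qed.

Lemma sum_siteM_cons z : \sum_(a : site) siteM m (a :: z) = siteM m z.
Proof.
case: mP => _ _ ml _; rewrite sum_site /siteM -ml mulr_suml.
apply: eq_bigr => b _; rewrite -[RHS]mulr1 -[X in _ = _ * X]sum_coinw mulr_sumr.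
by apply: eq_bigr => c _; rewrite big_cons /= mulrAC mulrA.
Qed.

Lemma sum_siteM_rcons z : \sum_(a : site) siteM m (rcons z a) = siteM m z.
Proof.
case: mP => _ _ _ mr; rewrite sum_site /siteM -mr mulr_suml.
apply: eq_bigr => b _; rewrite -[RHS]mulr1 -[X in _ = _ * X]sum_coinw mulr_sumr.
apply: eq_bigr => c _.
by rewrite big_rcons /= /unzip1 map_rcons mulrA.
Qed.

(** Together with [Ex_rcons], this is how stationarity is used: a count is moved to a smaller window
    by dropping end sites it ignores. *)
Lemma Ex_cons n F G : (forall a z, size z = n -> F (a :: z) = G z) ->
  Ex m n.+1 F = Ex m n G.
Proof.
move=> FG; rewrite /Ex big_words_cons exchange_big big_seq [RHS]big_seq.
apply: eq_bigr => z; rewrite mem_words => /eqP zn.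
by under eq_bigr do rewrite FG //; rewrite sumrMnl sum_siteM_cons.
Qed.

Lemma Ex_rcons n F G : (forall z a, size z = n -> F (rcons z a) = G z) ->
  Ex m n.+1 F = Ex m n G.
Proof.
move=> FG; rewrite /Ex big_words_rcons big_seq [RHS]big_seq.
apply: eq_bigr => z; rewrite mem_words => /eqP zn.
by under eq_bigr do rewrite FG //; rewrite sumrMnl sum_siteM_rcons.
Qed.

(** Summing over the first new letter leaves an indicator that ignores the first old site; the last
    letter is symmetric. *)
Lemma consistent_nextm : consistent (nextm m).
Proof.
have exch n (F : bool -> seq site -> nat) :
    \sum_(b : bool) Ex m n (F b) = Ex m n (fun z => \sum_(b : bool) F b z)%N.
  by rewrite big_bool /= -ExD; apply: eq_Ex => z _; rewrite big_bool.
split.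
- by move=> s; apply: sumr_ge0 => z _; exact: siteM_ge0.
- rewrite (@nextmE _ _ 0) //.
  case: mP => _ m1 _ mr.
  rewrite (@Ex_rcons _ _ (fun => 1%N)); last by case=> [|a []].
  rewrite (@Ex_rcons _ _ (fun => 1%N)); last by case.
  by rewrite /Ex big_seq1 /siteM /= m1 big_nil mulr1.
- move=> s; rewrite [RHS](@nextmE _ _ (size s)) //.
  under eq_bigr do rewrite (@nextmE _ _ (size s).+1) //.
  rewrite exch; apply: Ex_cons => a z zs; rewrite big_bool.
  case: z zs => [|b [|c z]] // _; rewrite scan_cons !eqseq_cons.
  by case: (upd a b c) => //=; rewrite addn0.
- move=> s; rewrite [RHS](@nextmE _ _ (size s)) //.
  under eq_bigr do rewrite (@nextmE _ _ (size s).+1) ?size_rcons //.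
  rewrite exch; apply: Ex_rcons => z c zs; rewrite big_bool.
  case/lastP: z zs => // z b; case/lastP: z => [|z a]; rewrite ?size_rcons // => _.
  rewrite scan_rcons !eqseq_rcons.
  by case: (upd a b c) => //=; rewrite ?andbT ?andbF ?addn0.
Qed.

(** * One-step change of the boundary density and of the red density *)

Definition lone b : seq bool := [:: b; ~~ b; b].
Definition boundary_density (m : seq bool -> R) :=
  m [:: true; false] + m [:: false; true].

Lemma boundary_densityE : boundary_density m =
  Ex m 2 (fun z => (nth (true, true) z 0).1 != (nth (true, true) z 1).1).
Proof.
rewrite /boundary_density -(@Ex_colour m [:: true; false]).
rewrite -(@Ex_colour m [:: false; true]) /= -ExD.
by apply: eq_Ex => -[|[[] c] [|[[] c'] []]].
Qed.

(** Naive move of the boundary between [a] and [b], ignoring all others: a succeeding side overruns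
    a failing one, and equal coins leave the boundary in place. *)
Definition moves_right (a b : site) : bool := [&& a.1 != b.1, a.2 & ~~ b.2].
Definition moves_left (a b : site) : bool := [&& a.1 != b.1, ~~ a.2 & b.2].
Definition stays (a b : site) : bool := (a.1 != b.1) && (a.2 == b.2).

Definition merging (b : bool) : seq site :=
  [:: (b, true); (~~ b, false); (b, false)].

(* Each new boundary comes from an old one at distance at most 1, and when the
   coins around a run of length 1 read [merging], two boundaries meet and none
   is left. *)
Lemma boundary_density_nextm :
  boundary_density (nextm m) +
    2 * alpha * (1 - alpha) ^+ 2 * (m (lone true) + m (lone false))
  <= boundary_density m.
Proof.
rewrite {1}/boundary_density !(@nextmE _ _ 2) // -ExD.
pose e := (true, true).
pose S (z : seq site) := ((z == merging true) + (z == merging false))%N.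
pose M1 (f : site -> site -> bool) (z : seq site) : nat :=
  f (nth e z 0) (nth e z 1).
(* Each merging pattern has coin weight [alpha * (1 - alpha) ^+ 2]. It brings two boundaries to the
   middle bond that cancel, hence [S] twice. *)
have -> : 2 * alpha * (1 - alpha) ^+ 2 * (m (lone true) + m (lone false))
    = Ex m 4 (fun z => S (take 3 z) + S (take 3 z))%N.
  rewrite ExD (@Ex_rcons 3 _ S); last by move=> z a zs; rewrite -cats1 take_size_cat.
  rewrite /S ExD (Ex_point _ (merging true)) (Ex_point _ (merging false)).
  by rewrite /siteM /= /lone /= !big_cons !big_nil /coinw /=; ring.
rewrite -ExD boundary_densityE.
(* Number of old boundaries whose naive move ends at the middle bond of the four sites. Stationarity
   brings its three terms back to a single bond. *)
pose M3 z := (M1 moves_right (take 2 z) + M1 stays (take 2 (behead z)) +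
  M1 moves_left (behead (behead z)))%N.
apply: (@le_trans _ _ (Ex m 4 M3)); last first.
  rewrite !ExD.
  rewrite (@Ex_rcons 3 _ (fun z => M1 moves_right (take 2 z))); last first.
    by move=> [|? [|? [|? []]]].
  rewrite (@Ex_rcons 2 _ (M1 moves_right)); last by move=> [|? [|? []]].
  rewrite (@Ex_rcons 3 _ (fun z => M1 stays (behead z))); last first.
    by move=> [|? [|? [|? []]]].
  rewrite (@Ex_cons 2 _ (M1 stays)); last by move=> ? [|? [|? []]].
  rewrite (@Ex_cons 3 _ (fun z => M1 moves_left (behead z))) //.
  rewrite (@Ex_cons 2 _ (M1 moves_left)) // -!ExD.
  by apply: le_Ex => -[|[[] []] [|[[] []] []]].
apply: le_Ex => -[|a [|b [|c [|d [|]]]]] // _.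
by case: a b c d => [[] []] [[] []] [[] []] [[] []].
Qed.

(* The balance of reds gained and lost at boundaries vanishes; the excess comes
   from a red site lost to both neighbours being counted only once. *)
Lemma nextm_red :
  nextm m [:: true] <= m [:: true] + m (lone false).
Proof.
pose pat (a b : site) (z : seq site) : nat := z == [:: a; b].
(* [F] adds the reds lost to each neighbour, [G] the reds gained from each. In expectation these
   terms cancel: both sides have one pattern for each two-colour word, with coin weight
   [alpha * (1 - alpha)]. *)
pose F (z : seq site) := ((scan z == [:: true]) +
  (pat (false, true) (true, false) (take 2 z) +
   pat (true, false) (false, true) (behead z)))%N.
pose G (z : seq site) := ((unzip1 (behead (take 2 z)) == [:: true]) +
  (pat (true, true) (false, false) (take 2 z) +
   pat (false, false) (true, true) (behead z)) +
  (unzip1 z == lone false))%N.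
have : Ex m 3 F <= Ex m 3 G.
  apply: le_Ex => -[|a [|b [|c [|]]]] // _.
  by case: a b c => [[] []] [[] []] [[] []].
have take2 f : Ex m 3 (fun z => f (take 2 z)) = Ex m 2 f.
  by apply: Ex_rcons => z a zs; rewrite -cats1 take_size_cat.
have behead2 f : Ex m 3 (fun z => f (behead z)) = Ex m 2 f by exact: Ex_cons.
have middle :
    Ex m 3 (fun z => unzip1 (behead (take 2 z)) == [:: true]) = m [:: true].
  rewrite (take2 (fun z => unzip1 (behead z) == [:: true])).
  by rewrite (@Ex_cons 1 _ (fun z => unzip1 z == [:: true])) //
    (@Ex_colour m [:: true]).
rewrite /F /G !ExD middle -(@nextmE _ [:: true] 1) // (@Ex_colour m (lone false)).
rewrite !behead2 !take2 !(@Ex_point m [:: _; _]).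
by rewrite /siteM /= !big_cons !big_nil /coinw /=; lra.
Qed.

(** * Runs of one colour *)

Definition run b k : seq bool := b :: rcons (nseq k (~~ b)) b.

Lemma run1 b : run b 1 = lone b. Proof. by []. Qed.

(* The left end of the run moves inwards when the first site of the run fails
   and all other coins succeed. *)
Lemma nextm_run b k :
  (1 - alpha) * alpha ^+ k.+4 * m (run b k.+2) <= nextm m (run b k.+1).
Proof.
have [_ _ _ mr] := mP.
pose y : seq site := rcons (nseq k.+1 (~~ b, true)) (b, true).
have y1 : all snd y by rewrite /y all_rcons all_nseq orbT.
have uy : unzip1 y = rcons (nseq k.+1 (~~ b)) b.
  by rewrite /y /unzip1 map_rcons map_nseq.
have wy : \prod_(a <- y) coinw a.2 = alpha ^+ k.+2.
  by rewrite /y big_rcons big_nseq iter_mulr_1 /= -exprSr.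
clearbody y.
(* The window for the shorter run is one site longer than the old run; the colour [c] of this extra
   site is free and is summed out. *)
pose z c : seq site := [:: (b, true), (~~ b, false) & rcons y (c, true)].
have uz c : unzip1 (z c) = rcons (run b k.+2) c.
  by rewrite /z /= /unzip1 map_rcons -/(unzip1 y) uy.
have scanz c : scan (z c) = run b k.+1.
  have := scan_frozen (~~ b, false) (c, true) y1; rewrite uy /z.
  by case: y {y1 uy wy z uz} => [|a y] //= ->; rewrite /upd /=; case: (b).
have szz c : size (z c) = (size (run b k.+1)).+2.
  by rewrite -(size_map fst) -/(unzip1 _) uz /= !size_rcons !size_nseq.
have siteMz c :
    siteM m (z c) = (1 - alpha) * alpha ^+ k.+4 * m (rcons (run b k.+2) c).
  rewrite /siteM uz mulrC /z !big_cons big_rcons wy /= /coinw.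
  by rewrite !exprS; ring.
rewrite (@nextmE _ _ _ erefl) -mr mulr_sumr.
under eq_bigr do rewrite -siteMz -Ex_point szz.
rewrite big_bool /= -ExD; apply: le_Ex => u _.
have zz : z true != z false by rewrite /z !eqseq_cons eqseq_rcons /= !andbF.
have [->|_] := eqVneq u (z true); first by rewrite (negbTE zz) scanz eqxx.
by have [->|] := eqVneq u (z false); rewrite ?scanz ?eqxx.
Qed.

(** For positive [k], a boundary followed by a run of length at least [k]. *)
Definition clump b k : seq bool := b :: nseq k (~~ b).

Lemma clumpS b k : m (clump b k) = m (clump b k.+1) + m (run b k).
Proof.
have [_ _ _ mr] := mP; rewrite -mr big_bool /run /clump -!rcons_cons.
have -> : nseq k.+1 (~~ b) = rcons (nseq k (~~ b)) (~~ b).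
  by rewrite -addn1 nseqD cats1.
by case: b => //=; rewrite addrC.
Qed.

Lemma nseq_clump b k : m (nseq k (~~ b)) = m (nseq k.+1 (~~ b)) + m (clump b k).
Proof.
by have [_ _ ml _] := mP; rewrite -ml big_bool /clump; case: b => //=; rewrite addrC.
Qed.

(* The clump probabilities decrease in [k] and sum to at most 1, because
   [m (clump b k) = m (nseq k (~~ b)) - m (nseq k.+1 (~~ b))]. *)
Lemma le_clump b k : m (clump b k) <= k.+1%:R^-1.
Proof.
have [m0 m1 _ _] := mP.
have clump_le n : (n <= k)%N -> m (clump b k) <= m (clump b n).
  elim: k => [|j IH]; first by rewrite leqn0 => /eqP ->.
  rewrite leq_eqVlt => /predU1P[->//|/IH]; apply: le_trans.
  by rewrite (clumpS _ j) lerDl.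
have sum_le n : (n <= k.+1)%N ->
    n%:R * m (clump b k) + m (nseq n (~~ b)) <= 1.
  elim: n => [_|n IH nk]; first by rewrite mul0r add0r m1.
  apply: le_trans (IH (ltnW nk)).
  have := clump_le n nk; rewrite (nseq_clump b n) -natr1; lra.
rewrite -[leRHS]mul1r ler_pdivlMr ?ltr0n // mulrC.
by apply: le_trans (sum_le _ (leqnn _)); rewrite lerDl.
Qed.

End consistent.

(** * Long-time limits of word probabilities *)

Section limits.
Variables (R : realType) (alpha : R).
Hypothesis alpha01 : 0 < alpha < 1.
Variable m : nat -> seq bool -> R.
Hypotheses (m0P : consistent (m 0)) (mS : forall t, m t.+1 = nextm alpha (m t)).

Lemma consistent_m t : consistent (m t).
Proof. by elim: t => // t IH; rewrite mS; exact: consistent_nextm. Qed.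

Let m_ge0 t s : 0 <= m t s. Proof. by case: (consistent_m t). Qed.

Lemma consistent_le1 t s : m t s <= 1.
Proof.
have [m0 m1 ml _] := consistent_m t.
elim: s => [|b s IH]; first by rewrite m1.
by apply: le_trans IH; rewrite -[leRHS]ml (bigD1 b) //= lerDl sumr_ge0.
Qed.

Let D t := boundary_density (m t).
Let c := 2 * alpha * (1 - alpha) ^+ 2.

Let c_gt0 : 0 < c.
Proof. have /andP[a0 a1] := alpha01; rewrite !mulr_gt0 ?exprn_gt0 //; lra. Qed.

Lemma lone_runs_le t :
  c * (m t (lone true) + m t (lone false)) <= D t - D t.+1.
Proof.
have := boundary_density_nextm alpha01 (consistent_m t).
by rewrite -mS lerBrDl.
Qed.

Let D_cvg : cvgn D.
Proof.
apply: nonincreasing_is_cvgn.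
  apply/nonincreasing_seqP => t; rewrite -subr_ge0.
  apply: le_trans (lone_runs_le t).
  by rewrite mulr_ge0 ?addr_ge0 // ltW.
by exists 0 => _ [t _ <-]; rewrite addr_ge0.
Qed.

(** Length 1 is controlled by the increments of the convergent sequence [D], and each longer run by
    a run one shorter at the next time. *)
Lemma run_cvg b k : m ^~ (run b k.+1) @ \oo --> 0.
Proof.
elim: k => [|k IH].
  apply: (@squeeze_cvgr _ _ _ _ (fun=> 0) (fun t => c^-1 * (D t - D t.+1))).
  - near=> t; rewrite m_ge0 run1 /= -(ler_pM2l c_gt0) mulrA divff ?gt_eqF //.
    rewrite mul1r; apply: le_trans (lone_runs_le t); rewrite ler_pM2l //.
    by case: b; rewrite (lerDl, lerDr).
  - exact: cvg_cst.
  - rewrite -[X in _ --> X](mulr0 c^-1) -(subrr (limn D)).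
    apply: cvgMl_tmp; apply: cvgB => //.
    by rewrite (cvg_shiftS D).
have /andP[a0 a1] := alpha01.
pose C := (1 - alpha) * alpha ^+ k.+4.
have C0 : 0 < C by rewrite mulr_gt0 ?exprn_gt0 ?subr_gt0.
apply: (@squeeze_cvgr _ _ _ _ (fun=> 0) (fun t => C^-1 * m t.+1 (run b k.+1))).
- near=> t; rewrite m_ge0 /= -(ler_pM2l C0) mulrA divff ?gt_eqF // mul1r mS.
  exact: (nextm_run alpha01 (consistent_m t)).
- exact: cvg_cst.
- rewrite -[X in _ --> X](mulr0 C^-1).
  by apply: cvgMl_tmp; rewrite (cvg_shiftS (m ^~ _)).
Unshelve. all: by end_near. Qed.

(** The run after the boundary is either one of finitely many short ones, each of vanishing
    probability, or long, with a bound uniform in time. *)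
Lemma clump1_cvg b : m ^~ (clump b 1) @ \oo --> 0.
Proof.
have clumpE t k : m t (clump b 1) =
    \sum_(j < k) m t (run b j.+1) + m t (clump b k.+1).
  elim: k => [|k IH]; first by rewrite big_ord0 add0r.
  rewrite IH big_ord_recr /= -addrA (clumpS (consistent_m t) b k.+1).
  by congr (_ + _); rewrite addrC.
apply/cvgr0Pnorm_lt => e e0.
(* Then [k.+1] exceeds [2 / e], so the tail, at most [k.+2%:R^-1], is at most [e / 2]. *)
pose k := Num.truncn (2 / e).
have sum_cvg n : (fun t => \sum_(j < n) m t (run b j.+1)) @ \oo --> 0.
  elim: n => [|n IH].
    by under eq_fun do rewrite big_ord0; exact: cvg_cst.
  under eq_fun do rewrite big_ord_recr /=.
  by have := cvgD IH (run_cvg b n); rewrite addr0; exact.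
have e2 : 0 < e / 2 by rewrite divr_gt0.
move/cvgr0Pnorm_lt : (sum_cvg k) => /(_ _ e2); apply: filterS => t.
rewrite ger0_norm ?sumr_ge0 // => lt1.
rewrite ger0_norm // (clumpE t k) (splitr e) ltr_leD //.
apply: le_trans (le_clump (consistent_m t) b k.+1) _.
rewrite -[leRHS]invrK lef_pV2 ?posrE ?invr_gt0 ?ltr0n // invf_div.
apply: ltW; apply: (@lt_le_trans _ _ k.+1%:R); last by rewrite ler_nat.
exact: truncnS_gt.
Qed.

Lemma clump_cvg b k : m ^~ (clump b k.+1) @ \oo --> 0.
Proof.
apply: (@squeeze_cvgr _ _ _ _ (fun=> 0) (m ^~ (clump b 1))).
- near=> t; rewrite m_ge0 /=.
  elim: k => // k; apply: le_trans.
  by rewrite (clumpS (consistent_m t) b k.+1) lerDl.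
- exact: cvg_cst.
- exact: clump1_cvg.
Unshelve. all: by end_near. Qed.

(* The red density increases by at most a multiple of the loss of boundary
   density, so a combination of the two is nonincreasing. *)
Lemma red_cvg : cvgn (fun t => m t [:: true]).
Proof.
have -> : (fun t => m t [:: true]) =
    (fun t => (m t [:: true] + c^-1 * D t) - c^-1 * D t).
  by apply/funext => t; rewrite addrK.
apply: is_cvgB; last exact: is_cvgMl_tmp.
apply: nonincreasing_is_cvgn; last first.
  exists 0 => _ [t _ <-].
  by rewrite addr_ge0 // mulr_ge0 ?invr_ge0 ?(ltW c_gt0) // addr_ge0.
apply/nonincreasing_seqP => t.
have := nextm_red alpha01 (consistent_m t); rewrite -mS => le1.
have : m t (lone false) <= c^-1 * (D t - D t.+1).
  rewrite -(ler_pM2l c_gt0) mulrA divff ?gt_eqF // mul1r.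
  by apply: le_trans (lone_runs_le t); rewrite ler_pM2l // lerDr.
by move: le1; rewrite mulrBr; lra.
Qed.

Lemma nseq_cvg : exists2 q : R, 0 <= q <= 1 & forall k,
  m ^~ (nseq k.+1 true) @ \oo --> q /\ m ^~ (nseq k.+1 false) @ \oo --> 1 - q.
Proof.
exists (limn (fun t => m t [:: true])).
  apply/andP; split.
    by apply: limr_ge; [exact: red_cvg|near=> t; exact: m_ge0].
  by apply: limr_le; [exact: red_cvg|near=> t; exact: consistent_le1].
(* Lengthening a monochromatic word costs only a clump probability, so the limit does not depend on
   the length. *)
have step b (l : R) : m ^~ [:: b] @ \oo --> l ->
    forall k, m ^~ (nseq k.+1 b) @ \oo --> l.
  move=> cv; elim=> // k IH.
  have -> : m ^~ (nseq k.+2 b) =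
      (fun t => m t (nseq k.+1 b) - m t (clump (~~ b) k.+1)).
    apply/funext => t.
    by have := nseq_clump (consistent_m t) (~~ b) k.+1;
      rewrite negbK => ->; rewrite addrK.
  by rewrite -[l]subr0; apply: cvgB => //; exact: clump_cvg.
move=> k; split; apply: step; first exact: red_cvg.
have -> : m ^~ [:: false] = (fun t => 1 - m t [:: true]).
  apply/funext => t; have [_ m1 ml _] := consistent_m t.
  by have := ml [::]; rewrite m1 big_bool /=; lra.
by apply: cvgB; [exact: cvg_cst|exact: red_cvg].
Unshelve. all: by end_near. Qed.

End limits.

(** * Finite-dimensional laws of the process *)

Fixpoint word (A : Type) (x : int -> A) (i : int) (n : nat) : seq A :=
  if n is n'.+1 then x i :: word x (i + 1) n' else [::].

Lemma word_rcons A (x : int -> A) i n :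
  word x i n.+1 = rcons (word x i n) (x (i + n%:Z)).
Proof.
elim: n i => [|n IH] i; first by rewrite /= addr0.
by rewrite [LHS]/= -/(word x (i + 1) n.+1) IH /= -addrA -PoszD add1n.
Qed.

Lemma word_shift (x : config) i k n :
  word (Defs.shift k x) i n = word x (i + k) n.
Proof. by elim: n i => //= n IH i; rewrite IH addrAC. Qed.

Lemma word_nseq A (x : int -> A) i n a :
  word x i n = nseq n a <-> forall k, (k < n)%N -> x (i + k%:Z) = a.
Proof.
elim: n i => [|n IH] i //=; split.
  move=> [xi /IH xn] [_|k kn]; first by rewrite addr0.
  by rewrite -add1n PoszD addrA xn.
move=> xn; congr cons; first by rewrite -(xn 0) // addr0.
by apply/IH => k kn; rewrite -addrA -PoszD add1n xn.
Qed.

Definition sites (x : config) (coin : bool -> int -> bool) (j : int) : site :=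
  (x j, coin (x j) j).

(** Suppose the coin at [i] fails. Without an opposite success the other proportion is 0. With one,
    either a single neighbour is opposite and 1 beats at most 1/2, or both are and at least 1/2
    beats 0. *)
Lemma chameleon_stepE x coin i : chameleon_step x coin i =
  upd (sites x coin (i - 1)) (sites x coin i) (sites x coin (i + 1)).
Proof.
rewrite /chameleon_step /proportion /neighbourhood /upd /sites /=.
move: (coin (x (i - 1)) _) (coin (x i) _) (coin (x (i + 1)) _).
move: (x (i - 1)) (x i) (x (i + 1)).
by do 6!case; vm_compute.
Qed.

Lemma word_step x coin i n : word (chameleon_step x coin) i n =
  scan (word (sites x coin) (i - 1) n.+2).
Proof.
elim: n i => //= n IH i.
by rewrite chameleon_stepE IH /= !addrK ?subrK.
Qed.

Section measure_of_words.
Context d (T : measurableType d) (R : realType) (P : probability T R).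

Definition pr (A : set T) : R := fine (P A).

Lemma prE A : measurable A -> (pr A)%:E = P A.
Proof. by move=> mA; rewrite fineK // fin_num_measure. Qed.

Lemma measurable_fiber (g : T -> bool) b :
  measurable_fun setT g -> measurable [set w | g w = b].
Proof.
by move=> mg; rewrite -[X in measurable X]setTI; exact: (mg measurableT [set b]).
Qed.

Lemma pr_bool (g : T -> bool) A : measurable_fun setT g -> measurable A ->
  pr A = \sum_(b : bool) pr (A `&` [set w | g w = b]).
Proof.
move=> mg mA; rewrite big_bool /=.
apply: EFin_inj; rewrite EFinD !prE //; try exact/measurableI/measurable_fiber.
rewrite (measureDI P mA (measurable_fiber true mg)) addeC; congr (_ + P _)%E.
by congr (P _); apply/seteqP; split => w [Aw] /=; case: (g w).
Qed.

Lemma measurable_word (f : int -> T -> bool) i s :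
  (forall j, measurable_fun setT (f j)) ->
  measurable [set w | word (f ^~ w) i (size s) = s].
Proof.
move=> mf; elim: s i => [|b s IH] i /=.
  by rewrite (_ : [set _ | _] = setT) //; apply/seteqP.
rewrite (_ : [set _ | _] = [set w | f i w = b] `&`
  [set w | word (f ^~ w) (i + 1) (size s) = s]).
  by apply: measurableI => //; exact: measurable_fiber.
by apply/seteqP; split => w /= [-> ->].
Qed.

Lemma pr_words (f : int -> T -> site) A i n :
  (forall j, measurable_fun setT (fun w => (f j w).1)) ->
  (forall j, measurable_fun setT (fun w => (f j w).2)) ->
  measurable A ->
  pr A = \sum_(z <- words site n) pr (A `&` [set w | word (f ^~ w) i n = z]).
Proof.
move=> mf1 mf2; elim: n A i => [|n IH] A i mA.
  by rewrite big_seq1; congr pr; apply/seteqP; split => w //= -[].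
rewrite big_words_cons sum_site (pr_bool (mf1 i) mA).
apply: eq_bigr => b _; rewrite (pr_bool (mf2 i)); last first.
  by apply: measurableI => //; exact: measurable_fiber.
apply: eq_bigr => c _; rewrite (IH _ (i + 1)); last first.
  by apply: measurableI; [apply: measurableI => //|]; exact: measurable_fiber.
apply: eq_bigr => z _; congr pr; apply/seteqP; split => w /=.
  by move=> [[[Aw]]]; case: (f i w) => /= ? ? -> -> ->.
by move=> [Aw [-> ->]].
Qed.

End measure_of_words.

(** * Word probabilities of the initial law *)

Section initial_law.
Context (R : realType) (P0 : probability config R).

Definition marginal (s : seq bool) : R := pr P0 [set x | word x 0 (size s) = s].

Lemma measurable_coordinate j : measurable_fun setT (fun x : config => x j).
Proof.
move: j; apply/(measurable_configP (fun x : config => x)); exact: measurable_id.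
Qed.

Lemma measurable_config_word i s :
  measurable [set x : config | word x i (size s) = s].
Proof.
exact: (@measurable_word _ config (fun j x => x j) i s measurable_coordinate).
Qed.

Hypothesis P0inv : translation_invariant P0.

Lemma marginal_shift i s : pr P0 [set x | word x i (size s) = s] = marginal s.
Proof.
rewrite /marginal /pr -[in RHS](P0inv i); last exact: measurable_config_word.
by congr (fine (P0 _)); apply/seteqP; split => x /=; rewrite word_shift add0r.
Qed.

Lemma consistent_marginal : consistent marginal.
Proof.
split.
- by move=> s; rewrite fine_ge0.
- rewrite /marginal /pr (_ : [set _ | _] = setT) ?probability_setT //.
  by apply/seteqP.
(* Reading [s] from site 1 leaves site 0 for the new first letter. *)
- move=> s; rewrite -(marginal_shift 1).
  rewrite (pr_bool _ (measurable_coordinate 0)); last exact: measurable_config_word.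
  apply: eq_bigr => b _; congr (pr P0 _); rewrite /= add0r.
  by apply/seteqP; split => x /= [-> ->].
- move=> s; rewrite [RHS]/marginal.
  rewrite (pr_bool _ (measurable_coordinate (size s))); last first.
    exact: measurable_config_word.
  apply: eq_bigr => b _; congr (pr P0 _).
  apply/seteqP; split => x; rewrite /= size_rcons word_rcons add0r.
    by move/rcons_inj => [-> ->].
  by move=> [-> ->].
Qed.

End initial_law.

(** Excludes contradictory values prescribed for the same coin. *)
Lemma uniq_unzip1_inj (A B : eqType) (L : seq (A * B)) a b b' :
  uniq (unzip1 L) -> (a, b) \in L -> (a, b') \in L -> b = b'.
Proof.
elim: L => //= -[a0 b0] L IH /andP[a0L uL].
have notin c : (a0, c) \notin L by apply: contra a0L => /(map_f fst).
rewrite !inE !xpair_eqE => /orP[/andP[/eqP-> /eqP->]|abL].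
  by rewrite eqxx (negbTE (notin _)) orbF => /eqP.
move=> /orP[/andP[/eqP aa0 _]|]; last exact: IH.
by rewrite aa0 (negbTE (notin _)) in abL.
Qed.

(** * Joint law of the present colours and the coins not yet used *)

Section finite_dimensional_laws.
Context (R : realType) (alpha : R) (P0 : probability config R).
Hypothesis alpha01 : 0 < alpha < 1.
Hypothesis P0inv : translation_invariant P0.
Context d (T : measurableType d) (P : probability T R).
Variables (xi0 : {mfun T >-> config})
  (C : bool -> int -> nat -> {mfun T >-> bool}).
Hypothesis data : chameleon_data P alpha P0 xi0 C.

Definition law t : seq bool -> R := iter t (nextm alpha) (marginal P0).

Notation key := (bool * int * nat)%type.
Let coin (k : key) : T -> bool := C k.1.1 k.1.2 k.2.
Let tosses (L : seq (key * bool)) :=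
  [set w | all (fun kv => coin kv.1 w == kv.2) L].
Let weight (L : seq (key * bool)) : R := \prod_(kv <- L) coinw alpha kv.2.

Let measurable_coin k : measurable_fun setT (coin k).
Proof. exact: measurable_funPT. Qed.

Let measurable_tosses L : measurable (tosses L).
Proof.
elim: L => [|kv L IH]; rewrite /tosses /=.
  by rewrite (_ : [set _ | _] = setT) //; apply/seteqP.
rewrite (_ : [set _ | _] = [set w | coin kv.1 w = kv.2] `&` tosses L).
  by apply: measurableI => //; exact: measurable_fiber.
by apply/seteqP; split => w /=; [move=> /andP[/eqP]|move=> [-> ->]; rewrite eqxx].
Qed.

Let tosses_cat L1 L2 w : tosses (L1 ++ L2) w <-> tosses L1 w /\ tosses L2 w.
Proof. by rewrite /tosses /= all_cat; split=> /andP. Qed.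

Let weight_cat L1 L2 : weight (L1 ++ L2) = weight L1 * weight L2.
Proof. exact: big_cat. Qed.

Lemma pr_coin k b : pr P [set w | coin k w = b] = coinw alpha b.
Proof.
have [_ Plaw _] := data.
have := Plaw k.1.1 k.1.2 k.2 [set b]; rewrite /distribution /pushforward /pr.
rewrite -[X in P X]/[set w | coin k w = b] => ->.
rewrite bernoulli_probE; last by case/andP : alpha01 => /ltW -> /ltW ->.
rewrite /coinw !diracE; case: b.
  by rewrite mem_set // memNset // mule1 mule0 adde0.
by rewrite memNset // mem_set // mule1 mule0 add0e.
Qed.

Let pr_initial i s L : uniq (unzip1 L) ->
  pr P ([set w | word (xi0 w) i (size s) = s] `&` tosses L) = law 0 s * weight L.
Proof.
move=> uL; have [Pxi0 _ ind] := data.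
(* Independence asks for an event at every index. Membership of [(k, true)] in [L] gives the
   prescribed value at each key of [L], because keys are distinct. *)
pose E (o : option key) : set T :=
  if o is Some k then [set w | coin k w = ((k, true) \in L)]
  else [set w | word (xi0 w) i (size s) = s].
have Lval kv : kv \in L -> ((kv.1, true) \in L) = kv.2.
  case: kv => k [] kL //=; apply/negbTE/negP => kL'.
  by have := uniq_unzip1_inj uL kL kL'.
have EJ o : chameleon_sources xi0 C o (E o).
  case: o => [[[c j] t]|] /=.
    by exists [set (c, j, t, true) \in L] => //; rewrite setTI.
  exists [set x | word x i (size s) = s]; last by rewrite setTI.
  exact: measurable_config_word.
pose ks := None :: map Some (unzip1 L).
have uks : uniq ks.
  rewrite /= map_inj_uniq ?uL ?andbT; last by move=> ? ? [].
  by apply/negP => /mapP[].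
pose J : {fset option key} := [fset o in ks]%fset.
have Jks : perm_eq J ks.
  apply: uniq_perm => [||o] //.
  by rewrite in_fset.
have PNone : P (E None) = (law 0 s)%:E.
  rewrite /law /= -(marginal_shift P0inv i) prE; last exact: measurable_config_word.
  by rewrite -Pxi0 //; exact: measurable_config_word.
have PSome : (\prod_(kv <- L) P (E (Some kv.1)) = (weight L)%:E)%E.
  rewrite /weight -prodEFin big_seq [RHS]big_seq; apply: eq_bigr => kv kvL.
  by rewrite /= Lval // -(pr_coin kv.1) prE //; exact: measurable_fiber.
have := ind J E (fun o _ => EJ o).
rewrite (perm_big _ Jks) big_cons !big_map PNone PSome /= -EFinM => Pcap.
rewrite -[RHS]/(fine (law 0 s * weight L)%:E) -Pcap; congr (fine (P _)).
apply/seteqP; split => w /=.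
  move=> [ws /allP wL] o; rewrite /= (perm_mem Jks) inE => /predU1P[->//|].
  move=> /mapP[k /mapP[kv kvL ->] ->] /=; rewrite Lval //.
  exact/eqP/wL.
move=> wE; split; first by apply: (wE None); rewrite /= (perm_mem Jks) inE.
apply/allP => kv kvL; rewrite -(Lval _ kvL); apply/eqP.
apply: (wE (Some kv.1)); rewrite /= (perm_mem Jks) inE; apply/orP; right.
by rewrite !map_f.
Qed.

(** The coins that the sites use: each key carries the colour of its site, so the colours of [z] and
    these tosses together determine the window. *)
Fixpoint tosses_of (t : nat) (j : int) (z : seq site) : seq (key * bool) :=
  if z is a :: z' then (a.1, j, t, a.2) :: tosses_of t (j + 1) z' else [::].

Lemma tosses_of_keys t j z k :
  k \in unzip1 (tosses_of t j z) -> j <= k.1.2 /\ k.2 = t.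
Proof.
elim: z j => //= a z IH j; rewrite inE => /predU1P[->//|/IH[jk ->]].
by split=> //; lia.
Qed.

Lemma uniq_tosses_of t j z : uniq (unzip1 (tosses_of t j z)).
Proof.
elim: z j => //= a z IH j; rewrite IH andbT.
by apply/negP => /tosses_of_keys [/= jj _]; lia.
Qed.

Let weight_tosses_of t j z :
  weight (tosses_of t j z) = \prod_(a <- z) coinw alpha a.2.
Proof.
by elim: z j => [|a z IH] j; rewrite /weight ?big_nil //= !big_cons -/(weight _) IH.
Qed.

Let sites_tosses x t w j z :
  (forall k, x k = chameleon xi0 C t w k) ->
  word (sites x (fun c i => C c i t w)) j (size z) = z <->
  word x j (size z) = unzip1 z /\ tosses (tosses_of t j z) w.
Proof.
move=> _; elim: z j => [|a z IH] j //=; split.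
  move=> [<- /IH [-> wz]]; split => //=.
  by apply/andP; split => //; rewrite /coin.
move=> [[xa xz] /andP[/eqP wa wz]]; congr cons; last by apply/IH.
by rewrite /sites xa -[C _ _ _ _]/(coin (a.1, j, t) w) wa -surjective_pairing.
Qed.

(* The extra conditions on coins not yet used encode their independence from
   the present configuration, and make the induction on time go through. *)
Lemma pr_law_tosses t i s L :
  uniq (unzip1 L) -> all (fun kv => (t <= kv.1.2)%N) L ->
  pr P ([set w | word (chameleon xi0 C t w) i (size s) = s] `&` tosses L)
  = law t s * weight L.
Proof.
elim: t i s L => [|t IH] i s L uL tL; first exact: pr_initial.
pose Y (j : int) (w : T) :=
  sites (chameleon xi0 C t w) (fun c i => C c i t w) j.
have mX j : measurable_fun setT (fun w => chameleon xi0 C t w j).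
  by apply: (measurable_configP _).1; exact: measurable_chameleon.
have mY2 j : measurable_fun setT (fun w => (Y j w).2).
  rewrite (_ : (fun w => _) =
      (fun w => if chameleon xi0 C t w j then C true j t w else C false j t w)).
    by apply: measurable_fun_ifT => //; exact: measurable_funPT.
  by apply/funext => w; rewrite /Y /=; case: (chameleon _ _ _ _ _).
have mXs t' i' s' :
    measurable [set w | word (chameleon xi0 C t' w) i' (size s') = s'].
  apply: (measurable_word (f := fun j w => chameleon xi0 C t' w j)) => j.
  by apply: (measurable_configP _).1; exact: measurable_chameleon.
rewrite (@pr_words _ _ _ P Y _ (i - 1) (size s).+2 mX mY2); last exact: measurableI.
rewrite -[law t.+1 s]/(nextm alpha (law t) s) /nextm mulr_suml [RHS]big_mkcond.
rewrite big_seq [RHS]big_seq; apply: eq_bigr => z; rewrite mem_words => /eqP zs.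
have YP w : word (Y ^~ w) (i - 1) (size s).+2 = z <->
    word (chameleon xi0 C t w) (i - 1) (size z) = unzip1 z
      /\ tosses (tosses_of t (i - 1) z) w.
  by rewrite -zs; exact: sites_tosses.
have scanE w : word (chameleon xi0 C t.+1 w) i (size s) =
    scan (word (Y ^~ w) (i - 1) (size s).+2) by rewrite /= word_step.
case: ifPn => [/eqP zE|/eqP zE]; last first.
  rewrite (_ : _ `&` _ = set0) /pr ?measure0 //.
  by apply/seteqP; split => // w [[ws _] wz]; case: zE;
  rewrite -[RHS]ws -[RHS]/(word (chameleon xi0 C t.+1 w) i (size s)) scanE wz.
(* The new word becomes a wider word at time [t] with the coins used then. These are distinct from
   those of [L], whose times are later, so the induction hypothesis applies to the concatenation. *)
transitivity (pr P ([set w |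
    word (chameleon xi0 C t w) (i - 1) (size (unzip1 z)) = unzip1 z] `&`
    tosses (tosses_of t (i - 1) z ++ L))).
  congr (pr P _); apply/seteqP; split => w.
    by move=> [[_ wL] /YP[wX wz]]; split; [rewrite /= size_map|exact/tosses_cat].
  move=> [wX /tosses_cat[wz wL]].
  have Yw : word (Y ^~ w) (i - 1) (size s).+2 = z.
    by apply/YP; split => //; move: wX; rewrite /= size_map.
  have ws : word (chameleon xi0 C t.+1 w) i (size s) = s by rewrite scanE Yw.
  by [].
rewrite IH.
- by rewrite weight_cat weight_tosses_of /siteM mulrA.
- rewrite /unzip1 map_cat cat_uniq uniq_tosses_of uL andbT /=.
  apply/hasPn => k /mapP[kv kvL ->]; apply/negP => /tosses_of_keys [_ kt].
  by move/allP : tL => /(_ _ kvL); rewrite kt ltnn.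
- rewrite all_cat; apply/andP; split.
    by apply/allP => kv kvz; have /tosses_of_keys [_ ->] := map_f fst kvz.
  by apply: sub_all tL => kv /ltnW.
Qed.

Lemma pr_law t i s :
  pr P [set w | word (chameleon xi0 C t w) i (size s) = s] = law t s.
Proof.
have := @pr_law_tosses t i s [::] erefl erefl.
by rewrite /weight big_nil mulr1 => <-; congr pr; apply/seteqP; split => w /= -[].
Qed.

End finite_dimensional_laws.

(** * Weak convergence *)

Section continuous_functions.
Variable R : realType.

(** Otherwise some [y n] agree with [x] up to distance [n] while [f (y n)] stays away from [f x];
    but [y n] tends to [x] coordinatewise. *)
Lemma continuous_locality (f : config -> R) (x : config) (e : R) :
  continuous f -> 0 < e ->
  exists n : nat, forall y : config,
    (forall j : int, (`|j| <= n)%N -> y j = x j) -> `|f x - f y| < e.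
Proof.
move=> cf e0; apply: contrapT => /forallNP far.
have /choice[y yP] : forall n, exists y : config,
    (forall j : int, (`|j| <= n)%N -> y j = x j) /\ ~ `|f x - f y| < e.
  move=> n; have /existsNP[y /not_implyP[yx fy]] := far n.
  by exists y.
have yx : y n @[n --> \oo] --> (x : config).
  apply/cvg_sup => j A; rewrite nbhsE => -[_ [[B _ <-] Bx] BA].
  suff : \forall n \near \oo, A (y n) by [].
  near=> n; apply: BA; rewrite /= (yP n).1 //.
  by near: n; exact: nbhs_infty_ge.
have fyx : f (y n) @[n --> \oo] --> f x by apply: cvg_comp yx _; exact: cf.
have /cvgrPdist_lt/(_ e e0) := fyx.
by move=> [N _ /(_ N (leqnn N))]; exact: (yP N).2.
Unshelve. all: by end_near. Qed.

Definition centred (n : nat) (x : config) : seq bool :=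
  word x (- n%:Z) n.*2.+1.

(* Only meaningful at the sites [j] with [`|j| <= n]. *)
Definition extension (n : nat) (s : seq bool) : config :=
  fun j => nth red s (absz (j + n%:Z)).

Lemma nth_word (x : config) i n k : (k < n)%N ->
  nth red (word x i n) k = x (i + k%:Z).
Proof.
elim: n i k => // n IH i [|k] kn /=; first by rewrite addr0.
by rewrite IH // -addrA -PoszD add1n.
Qed.

Lemma extension_centred n x (j : int) : (`|j| <= n)%N ->
  extension n (centred n x) j = x j.
Proof.
move=> jn; rewrite /extension nth_word; last by lia.
by congr (x _); lia.
Qed.

Lemma measurable_word_fun (G : seq bool -> R) i n :
  measurable_fun setT (fun x : config => G (word x i n)).
Proof.
elim: n i G => [|n IH] i G /=; first exact: measurable_cst.
rewrite (_ : (fun x => _) = (fun x : config =>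
    if x i then G (true :: word x (i + 1) n) else G (false :: word x (i + 1) n))).
  apply: measurable_fun_ifT; first exact: measurable_coordinate.
    exact: (IH _ (fun s => G (true :: s))).
  exact: (IH _ (fun s => G (false :: s))).
by apply/funext => x; case: (x i).
Qed.

(** By locality, [f] is the pointwise limit of functions of finite windows. *)
Lemma continuous_measurable_config (f : config -> R) :
  continuous f -> measurable_fun setT f.
Proof.
move=> cf.
apply: (@measurable_fun_cvg _ _ _ _ (fun n x => f (extension n (centred n x)))).
  by move=> n; exact: (measurable_word_fun (fun s => f (extension n s))).
move=> x _; apply/cvgrPdist_lt => e e0.
have [N fN] := continuous_locality x cf e0.
near=> n; apply: fN => j jN; apply: extension_centred.
by apply: (leq_trans jN); near: n; exact: nbhs_infty_ge.
Unshelve. all: by end_near. Qed.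

Definition block (n : nat) (b : bool) : set config :=
  [set x | centred n x = nseq n.*2.+1 b].

Lemma blockP n b x : block n b x <-> forall j : int, (`|j| <= n)%N -> x j = b.
Proof.
split=> [/word_nseq xb j jn|xb].
  have := xb (absz (j + n%:Z)).
  rewrite (_ : - n%:Z + (absz (j + n%:Z))%:Z = j); last by lia.
  by apply; lia.
by apply/word_nseq => k kn; apply: xb; lia.
Qed.

Lemma measurable_block n b : measurable (block n b).
Proof.
have := measurable_config_word (- n%:Z) (nseq n.*2.+1 b).
by rewrite size_nseq.
Qed.

End continuous_functions.

(** * Integrals against laws with mostly monochromatic windows *)

Section integrals.
Variables (R : realType) (mu : {measure set config -> \bar R}).
Hypothesis mu1 : mu setT = 1%E.

Let mass b n : R := fine (mu (block n b)).

Lemma bounded_continuous_integrable (f : config -> R) :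
  continuous f -> bounded_fun f -> mu.-integrable setT (EFin \o f).
Proof.
move=> cf bf; apply: measurable_bounded_integrable => //.
- by rewrite mu1 ltry.
- exact: continuous_measurable_config.
Qed.

Let integrable_indicator n b : mu.-integrable setT (EFin \o \1_(block n b)).
Proof.
apply: measurable_bounded_integrable => //.
- by rewrite mu1 ltry.
- by apply: measurable_indic; exact: measurable_block.
- exists 1; split => // r r1 x _ /=; apply: le_trans (ltW r1).
  by rewrite indicE ger0_norm // lern1 leq_b1.
Qed.

(** The two blocks are disjoint: the value is [c + a] on the red one, [c + b] on the blue one and
    [c] elsewhere. *)
Definition block_step n (c a b : R) : config -> R :=
  fun x => c + (a * \1_(block n red) x + b * \1_(block n blue) x).

Lemma integrable_block_step n c a b :
  mu.-integrable setT (EFin \o block_step n c a b).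
Proof.
apply: measurable_bounded_integrable => //.
- by rewrite mu1 ltry.
- apply: measurable_funD => //.
  by apply: measurable_funD; apply: measurable_funM => //;
    apply: measurable_indic; exact: measurable_block.
- exists (`|c| + (`|a| + `|b|)); split; first exact: num_real.
  move=> r rM x _ /=; apply: le_trans (ltW rM).
  have ind_le1 k n' b' : `|k * \1_(block n' b') x| <= `|k| :> R.
    by rewrite normrM ler_piMr // indicE ger0_norm // lern1 leq_b1.
  apply: le_trans (ler_normD _ _) _; rewrite lerD2l.
  by apply: le_trans (ler_normD _ _) _; apply: lerD.
Qed.

Lemma Rintegral_block_step n c a b :
  \int[mu]_x block_step n c a b x = c + (a * mass red n + b * mass blue n).
Proof.
have icst : mu.-integrable setT (EFin \o (cst c : config -> R)).
  apply: eq_integrable (integrable_block_step n c 0 0) => // x _ /=.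
  by rewrite /block_step !mul0r !addr0.
have iindic b' k : mu.-integrable setT (EFin \o (fun x => k * \1_(block n b') x)).
  by apply: eq_integrable (integrableZl measurableT k (integrable_indicator n b')).
have Iindic b' k : \int[mu]_x (k * \1_(block n b') x) = k * mass b' n.
  rewrite RintegralZl //; congr (_ * _); rewrite /Rintegral integral_indic // ?setIT //.
  exact: measurable_block.
rewrite /block_step RintegralD //; last first.
  apply: eq_integrable (integrable_block_step n 0 a b) => // x _ /=.
  by rewrite /block_step add0r.
rewrite RintegralD // !Iindic Rintegral_cst // mu1 mulr1.
by [].
Qed.

Lemma Rintegral_close (f : config -> R) (M e : R) n :
  continuous f -> bounded_fun f -> (forall x, `|f x| <= M) -> 0 < e ->
  (forall x, block n red x -> `|f allred - f x| < e) ->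
  (forall x, block n blue x -> `|f allblue - f x| < e) ->
  `|\int[mu]_x f x - (f allred * mass red n + f allblue * mass blue n)|
    <= e + M * (1 - mass red n - mass blue n).
Proof.
move=> cf bf fM e0 fr fb.
have red_blue x : block n red x -> ~ block n blue x.
  by move=> /blockP/(_ 0 isT) x0 /blockP/(_ 0 isT); rewrite x0.
have fi := bounded_continuous_integrable cf bf.
(* The step function equals [f allred + e] and [f allblue + e] on the blocks, and [e + M] off
   them. *)
have upper : \int[mu]_x f x <=
    \int[mu]_x block_step n (e + M) (f allred - M) (f allblue - M) x.
  apply: le_Rintegral => //; first exact: integrable_block_step.
  move=> x _; rewrite /block_step !indicE.
  have := fM x; rewrite ler_norml => /andP[fx1 fx2].
  have [xr|xr] := pselect (block n red x).
    rewrite (mem_set xr) memNset; last exact: red_blue.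
    by have := fr x xr; rewrite ltr_norml => /andP[? ?]; rewrite /=; lra.
  have [xb|xb] := pselect (block n blue x).
    rewrite (mem_set xb) memNset //.
    by have := fb x xb; rewrite ltr_norml => /andP[? ?]; rewrite /=; lra.
  by rewrite !memNset //=; lra.
have lower : \int[mu]_x block_step n (- (e + M)) (f allred + M) (f allblue + M) x
    <= \int[mu]_x f x.
  apply: le_Rintegral => //; first exact: integrable_block_step.
  move=> x _; rewrite /block_step !indicE.
  have := fM x; rewrite ler_norml => /andP[fx1 fx2].
  have [xr|xr] := pselect (block n red x).
    rewrite (mem_set xr) memNset; last exact: red_blue.
    by have := fr x xr; rewrite ltr_norml => /andP[? ?]; rewrite /=; lra.
  have [xb|xb] := pselect (block n blue x).
    rewrite (mem_set xb) memNset //.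
    by have := fb x xb; rewrite ltr_norml => /andP[? ?]; rewrite /=; lra.
  by rewrite !memNset //=; lra.
move: upper lower; rewrite !Rintegral_block_step => upper lower.
by rewrite ler_norml; apply/andP; split; lra.
Qed.

End integrals.

Section weak_convergence.
Variables (R : realType) (q : {i01 R}).

Lemma mixtureE (A : set config) :
  mixture q A = (q%:num * \1_A allred + (1 - q%:num) * \1_A allblue)%:E.
Proof. by apply: etrans (measure_addE _ _ _) _; rewrite /= /mscale /= !diracE. Qed.

Lemma mixture_setT : mixture q setT = 1%E.
Proof. by rewrite mixtureE !indicE !mem_set // !mulr1 subrKC. Qed.

Lemma mixture_block n b :
  fine (mixture q (block n b)) = if b then q%:num else 1 - q%:num.
Proof.
have mem_block c : ((fun=> c) \in block n b) = (c == b).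
  by apply/idP/eqP => [/[!inE] /blockP/(_ 0 isT)|-> /[!inE]]; last exact/blockP.
rewrite mixtureE /= !indicE !mem_block.
by case: b {mem_block} => /=; rewrite mulr1 mulr0 ?addr0 ?add0r.
Qed.

(** Both integrals are close to the same combination of block masses; the mass off the blocks is 0
    for the mixture and tends to 0 along [mu]. *)
Lemma weakly_converges_mixture (mu : nat -> {measure set config -> \bar R}) :
  (forall t, mu t setT = 1%E) ->
  (forall n b, fine (mu t (block n b)) @[t --> \oo] -->
     (if b then q%:num else 1 - q%:num)) ->
  weakly_converges mu (mixture q).
Proof.
move=> mu1 mublock f cf bf.
have fint (nu : {measure set config -> \bar R}) : nu setT = 1%E ->
    (\int[nu]_x (f x)%:E = (\int[nu]_x f x)%:E)%E.
  move=> nu1; rewrite /Rintegral fineK //; apply: integrable_fin_num => //.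
  exact: bounded_continuous_integrable.
have [M0 [_ /(_ (`|M0| + 1))]] := bf.
rewrite (le_lt_trans (ler_norm _)) ?ltrDl // => /(_ isT).
set M := `|M0| + 1 => fM.
rewrite (fint _ mixture_setT).
rewrite (_ : (fun t => _) = EFin \o (fun t => \int[mu t]_x f x)); last first.
  by apply/funext => t; rewrite /= fint.
apply: cvg_EFin; first by near=> t.
apply/cvgrPdist_lt => e e0.
(* The error splits as [e / 4] for the mixture, [e / 4] for the block masses and [e / 2] for [mu t],
   whose bound [v t] tends to [e / 4]. *)
have e4 : 0 < e / 4 by rewrite divr_gt0.
have [nr fr] := continuous_locality allred cf e4.
have [nb fb] := continuous_locality allblue cf e4.
pose n := maxn nr nb.
have fr' x : block n red x -> `|f allred - f x| < e / 4.
  by move=> /blockP xr; apply: fr => j jn; apply: xr; rewrite leq_max jn.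
have fb' x : block n blue x -> `|f allblue - f x| < e / 4.
  by move=> /blockP xb; apply: fb => j jn; apply: xb; rewrite leq_max jn orbT.
have fM' x : `|f x| <= M by exact: fM.
have close nu nu1 :=
  @Rintegral_close R nu nu1 f M (e / 4) n cf bf fM' e4 fr' fb'.
have := close _ mixture_setT; rewrite !mixture_block /= => close_mixture.
pose u t := f allred * fine (mu t (block n red)) +
  f allblue * fine (mu t (block n blue)).
pose v t := e / 4 +
  M * (1 - fine (mu t (block n red)) - fine (mu t (block n blue))).
have u_cvg : u t @[t --> \oo] --> f allred * q%:num + f allblue * (1 - q%:num).
  by apply: cvgD; apply: cvgMl_tmp;
    [exact: (mublock n true)|exact: (mublock n false)].
have v_cvg : v t @[t --> \oo] --> e / 4.
  rewrite -[X in _ --> X]addr0 -(mulr0 M); apply: cvgD; first exact: cvg_cst.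
  apply: cvgMl_tmp; rewrite -(subrr (1 - q%:num)); apply: cvgB.
    by apply: cvgB; [exact: cvg_cst|exact: (mublock n true)].
  exact: (mublock n false).
near=> t.
have ut : `|f allred * q%:num + f allblue * (1 - q%:num) - u t| < e / 4.
  by near: t; move/cvgrPdist_lt : u_cvg; apply.
have vt : v t < e / 2.
  by near: t; apply: (cvgr_lt (e / 4)) => //; lra.
have := close _ (mu1 t); rewrite -/(u t) -/(v t) => close_t.
move: (close_mixture) close_t ut; rewrite !ler_norml !ltr_norml.
by move=> /andP[? ?] /andP[? ?] /andP[? ?]; apply/andP; split; lra.
Unshelve. all: by end_near. Qed.

End weak_convergence.

Theorem theorem8 (R : realType) (alpha p : R) (P0 : probability config R) :
  0 < alpha < 1 ->
  translation_invariant P0 ->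
  (forall i : int, P0 [set x : config | x i = red] = p%:E /\
                   P0 [set x : config | x i = blue] = (1 - p)%:E) ->
  exists pibar : {i01 R},
    forall (d : measure_display) (T : measurableType d) (P : probability T R)
      (xi0 : {mfun T >-> config})
      (C : bool -> int -> nat -> {mfun T >-> bool}),
      chameleon_data P alpha P0 xi0 C ->
      weakly_converges (fun t => distribution P (chameleon xi0 C t))
                       (mixture pibar).
Proof.
move=> alpha01 P0inv _.
(* [law] is computed from [alpha] and [P0] alone, so [q] is fixed before the probability space and
   the coins. *)
have [q /andP[q0 q1] qP] := nseq_cvg alpha01 (consistent_marginal P0inv)
  (fun t => erefl : law alpha P0 t.+1 = nextm alpha (law alpha P0 t)).
exists (Itv01 q0 q1) => d T P xi0 C data.
apply: weakly_converges_mixture => [t|n b]; first exact: probability_setT.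
have blockE t : fine (distribution P (chameleon xi0 C t) (block n b)) =
    law alpha P0 t (nseq n.*2.+1 b).
  rewrite -(pr_law alpha01 P0inv data t (- n%:Z)) /pr size_nseq.
  by [].
under eq_fun do rewrite blockE.
by case: b {blockE}; have [] := qP n.*2.
Qed.
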